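(* Let $\mathcal{A}$ be an abelian category. Then $\mathrm{ASpec}\,\mathcal{A}$ is a Kolmogorov space, i.e. for any two distinct atoms $\alpha_1,\alpha_2\in\mathrm{ASpec}\,\mathcal{A}$ there exists an open subclass of $\mathrm{ASpec}\,\mathcal{A}$ containing exactly one of them.
   Context: An object $H$ of an abelian category $\mathcal{A}$ is monoform if it is nonzero and, for every nonzero subobject $L$ of $H$, no nonzero subobject of $H$ is isomorphic to a subobject of $H/L$. Two monoform objects are atom-equivalent if they have a common nonzero subobject (up to isomorphism); this is an equivalence relation on monoform objects. The atom spectrum $\mathrm{ASpec}\,\mathcal{A}$ is the class of atom-equivalence classes of monoform objects (possibly not a set); its elements are called atoms and the class of $H$ is denoted $\overline{H}$. For an object $M$, the atom support is $\mathrm{ASupp}\,M=\{\overline{H}\mid H \text{ a monoform subquotient of } M\}$. Topology: a subclass $\Phi\subset\mathrm{ASpec}\,\mathcal{A}$ is open if for every $\alpha\in\Phi$ there is a monoform object $H$ with $\overline{H}=\alpha$ and $\mathrm{ASupp}\,H\subset\Phi$. *)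

(* Defs.v *)
From HB Require Import structures.
From mathcomp Require Import all_boot all_order all_algebra.
From mathcomp Require Import all_classical topology.

Set Implicit Arguments.
Unset Strict Implicit.
Unset Printing Implicit Defensive.
Import GRing.Theory.

Local Open Scope classical_set_scope.
Local Open Scope ring_scope.

Reserved Notation "g \oc f" (at level 50, left associativity).

Record preadditive := Preadditive {
  obj :> Type;
  hom : obj -> obj -> zmodType;
  idm : forall X, hom X X;
  comp : forall X Y Z, hom Y Z -> hom X Y -> hom X Z;
  comp_idl : forall X Y (f : hom X Y), comp (idm Y) f = f;
  comp_idr : forall X Y (f : hom X Y), comp f (idm X) = f;
  comp_assoc : forall W X Y Z (h : hom Y Z) (g : hom X Y) (f : hom W X),
    comp h (comp g f) = comp (comp h g) f;
  comp_addl : forall X Y Z (g g' : hom Y Z) (f : hom X Y),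
    comp (g + g') f = comp g f + comp g' f;
  comp_addr : forall X Y Z (g : hom Y Z) (f f' : hom X Y),
    comp g (f + f') = comp g f + comp g f' }.

Declare Scope cat_scope.
Delimit Scope cat_scope with cat.
Notation "g \oc f" := (comp g f) : cat_scope.
Local Open Scope cat_scope.

Section PreadditiveNotions.
Variable C : preadditive.
Implicit Types X Y Z W K Q P : C.

Definition mono X Y (f : hom X Y) : Prop :=
  forall W (g h : hom W X), f \oc g = f \oc h -> g = h.

Definition epi X Y (f : hom X Y) : Prop :=
  forall W (g h : hom Y W), g \oc f = h \oc f -> g = h.

Definition is_zero Z : Prop :=
  (forall X (f : hom Z X), f = 0) /\ (forall X (f : hom X Z), f = 0).

Definition is_kernel X Y (f : hom X Y) K (k : hom K X) : Prop :=
  f \oc k = 0 /\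
  forall W (g : hom W X), f \oc g = 0 -> exists! h : hom W K, k \oc h = g.

Definition is_cokernel X Y (f : hom X Y) Q (q : hom Y Q) : Prop :=
  q \oc f = 0 /\
  forall W (g : hom Y W), g \oc f = 0 -> exists! h : hom Q W, h \oc q = g.

Definition is_product X Y P (p1 : hom P X) (p2 : hom P Y) : Prop :=
  forall W (f : hom W X) (g : hom W Y),
    exists! h : hom W P, p1 \oc h = f /\ p2 \oc h = g.

End PreadditiveNotions.

Record is_abelian (C : preadditive) : Prop := IsAbelian {
  has_zero : exists Z : C, is_zero Z;
  has_products : forall X Y : C,
    exists P (p1 : hom P X) (p2 : hom P Y), is_product p1 p2;
  has_kernels : forall (X Y : C) (f : hom X Y),
    exists K (k : hom K X), is_kernel f k;
  has_cokernels : forall (X Y : C) (f : hom X Y),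
    exists Q (q : hom Y Q), is_cokernel f q;
  mono_is_kernel : forall (X Y Q : C) (f : hom X Y) (q : hom Y Q),
    mono f -> is_cokernel f q -> is_kernel q f;
  epi_is_cokernel : forall (X Y K : C) (f : hom X Y) (k : hom K X),
    epi f -> is_kernel f k -> is_cokernel k f }.

Record abelianCat := AbelianCat {
  cat :> preadditive;
  cat_abelian : is_abelian cat }.

Section AtomDefs.
Variable A : abelianCat.
Implicit Types H K L M N Q : A.

(* Subobjects and quotients are handled through representatives: a subobject
   of M is a monomorphism into M, and the quotient M/L by a monomorphism
   l : L -> M is the target of any cokernel of l. *)

(* N is isomorphic to a subobject of M *)
Definition embeds N M : Prop := exists f : hom N M, mono f.

(* K is isomorphic to M'/L for some subobjects L of M' and M' of M *)
Definition subquotient K M : Prop :=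
  exists M' (m : hom M' M) L (l : hom L M') (q : hom M' K),
    [/\ mono m, mono l & is_cokernel l q].

Definition monoform H : Prop :=
  ~ is_zero H /\
  forall L (l : hom L H) Q (q : hom H Q),
    mono l -> ~ is_zero L -> is_cokernel l q ->
    ~ exists N, [/\ ~ is_zero N, embeds N H & embeds N Q].

Definition atom_equiv H K : Prop :=
  exists N, [/\ ~ is_zero N, embeds N H & embeds N K].

Definition atom_class H : set A :=
  [set K | monoform K /\ atom_equiv H K].

End AtomDefs.

(* An atom is an equivalence class, that is, a class of monoform objects. *)
Record ASpec (A : abelianCat) := Atom {
  atom_set : set A;
  atom_setP : exists2 H : A, monoform H & atom_set = atom_class H }.

Definition atom_of (A : abelianCat) (H : A) (mH : monoform H) : ASpec A :=
  Atom (ex_intro2 _ _ H mH erefl).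

Definition ASupp (A : abelianCat) (M : A) : set (ASpec A) :=
  [set a | exists (H : A) (mH : monoform H), subquotient H M /\ a = atom_of mH].

Definition atom_open (A : abelianCat) (Phi : set (ASpec A)) : Prop :=
  forall a, Phi a ->
    exists (H : A) (mH : monoform H), atom_of mH = a /\ ASupp H `<=` Phi.

Section AbelianTheory.
Variable A : abelianCat.
Implicit Types H K L M N Q X Y Z W : A.

Lemma comp_0r X Y Z (g : hom Y Z) : g \oc (0 : hom X Y) = 0.
Proof. by apply: (@addrI _ (g \oc 0)); rewrite -comp_addr !addr0. Qed.

Lemma comp_0l X Y Z (f : hom X Y) : (0 : hom Y Z) \oc f = 0.
Proof. by apply: (@addrI _ (0 \oc f)); rewrite -comp_addl !addr0. Qed.

Lemma comp_oppr X Y Z (g : hom Y Z) (f : hom X Y) : g \oc (- f) = - (g \oc f).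
Proof. by apply/eqP; rewrite -addr_eq0 -comp_addr addNr comp_0r. Qed.

Lemma monoP X Y (f : hom X Y) :
  (forall W (g : hom W X), f \oc g = 0 -> g = 0) -> mono f.
Proof.
move=> f0 W g h fgh; apply/eqP; rewrite -subr_eq0; apply/eqP/f0.
by rewrite comp_addr comp_oppr fgh subrr.
Qed.

Lemma mono_eq0 X Y (f : hom X Y) W (g : hom W X) :
  mono f -> f \oc g = 0 -> g = 0.
Proof. by move=> mf fg; apply: mf; rewrite fg comp_0r. Qed.

Lemma mono_id X : mono (idm X).
Proof. by move=> W g h; rewrite !comp_idl. Qed.

Lemma mono_comp X Y Z (g : hom Y Z) (f : hom X Y) :
  mono g -> mono f -> mono (g \oc f).
Proof. by move=> mg mf W a b; rewrite -!comp_assoc => /mg/mf. Qed.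

Lemma epi_comp X Y Z (g : hom Y Z) (f : hom X Y) :
  epi g -> epi f -> epi (g \oc f).
Proof. by move=> eg ef W a b; rewrite !comp_assoc => /ef/eg. Qed.

Lemma kernel_mono X Y (f : hom X Y) K (k : hom K X) : is_kernel f k -> mono k.
Proof.
move=> [fk uk] W g h gh.
have [|x [_ ux]] := uk W (k \oc g); first by rewrite comp_assoc fk comp_0l.
by rewrite -(ux g erefl) -(ux h).
Qed.

Lemma cokernel_epi X Y (f : hom X Y) Q (q : hom Y Q) : is_cokernel f q -> epi q.
Proof.
move=> [qf uq] W g h gh.
have [|x [_ ux]] := uq W (g \oc q); first by rewrite -comp_assoc qf comp_0r.
by rewrite -(ux g erefl) -(ux h).
Qed.

Lemma zero_mono X Y (f : hom X Y) : mono f -> is_zero Y -> is_zero X.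
Proof.
move=> mf [_ Y0]; have X0 : forall W (g : hom W X), g = 0.
  by move=> W g; apply: (mono_eq0 mf); apply: Y0.
by split=> // W g; rewrite -[g]comp_idr (X0 _ (idm X)) comp_0r.
Qed.

Lemma kernel_zero_mono X Y (f : hom X Y) K (k : hom K X) :
  is_kernel f k -> is_zero K -> mono f.
Proof.
move=> [_ uk] [K0 _]; apply: monoP => W g /uk[h [<- _]].
by rewrite (K0 _ k) comp_0l.
Qed.

Lemma embeds_refl X : embeds X X.
Proof. by exists (idm X); apply: mono_id. Qed.

Lemma embeds_trans X Y Z : embeds X Y -> embeds Y Z -> embeds X Z.
Proof. by move=> [f mf] [g mg]; exists (g \oc f); apply: mono_comp. Qed.

Lemma quotient_mono L N H QN QH (l : hom L N) (n : hom N H)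
    (p : hom N QN) (q : hom H QH) :
  mono n -> mono (n \oc l) -> is_cokernel l p -> is_cokernel (n \oc l) q ->
  embeds QN QH.
Proof.
move=> mn mnl pl ql; have ab := cat_abelian A; have [p0 up] := pl.
have [f [fp _]] : exists! f, f \oc p = q \oc n.
  by apply: up; rewrite -comp_assoc; case: ql.
have [ql0 uql] := mono_is_kernel ab mnl ql.
have ep := cokernel_epi pl.
exists f; apply: monoP => K k fk.
have [E [e ke]] := has_cokernels ab k; have [ek ue] := ke.
have [f' [fe _]] := ue _ _ fk.
have [T [t tk]] := has_kernels ab (e \oc p).
have [ept _] := tk.
have [|s [ns _]] := uql _ (n \oc t).
  rewrite comp_assoc -fp -fe -(comp_assoc f' e p) -(comp_assoc f' (e \oc p) t).
  by rewrite ept comp_0r.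
have pt : p \oc t = 0.
  by move: ns; rewrite -comp_assoc => /mn <-; rewrite comp_assoc p0 comp_0l.
have [_ uep] := epi_is_cokernel ab (epi_comp (cokernel_epi ke) ep) tk.
have [u [uE _]] := uep _ _ pt.
have ue1 : u \oc e = idm QN by apply: ep; rewrite -comp_assoc uE comp_idl.
by rewrite -[k]comp_idl -ue1 -comp_assoc ek comp_0r.
Qed.

Lemma monoform_embeds N H : monoform H -> ~ is_zero N -> embeds N H -> monoform N.
Proof.
move=> [H0 mH] N0 [n mn]; split=> // L l Q q ml L0 lq [X [X0 XN XQ]].
have mnl := mono_comp mn ml.
have [Q' [q' lq']] := has_cokernels (cat_abelian A) (n \oc l).
apply: (mH _ _ _ _ mnl L0 lq'); exists X; split=> //.
  by apply: embeds_trans XN _; exists n.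
by apply: embeds_trans XQ _; apply: quotient_mono lq lq'.
Qed.

Lemma monoform_uniform N1 N2 H :
  monoform H -> ~ is_zero N1 -> ~ is_zero N2 -> embeds N1 H -> embeds N2 H ->
  atom_equiv N1 N2.
Proof.
move=> [_ mH] N10 N20 [n1 mn1] [n2 mn2]; have ab := cat_abelian A.
have [Q [q n2q]] := has_cokernels ab n2.
have [K [k kk]] := has_kernels ab (q \oc n1).
have [K0|K0] := pselect (is_zero K).
  case: (mH _ _ _ _ mn2 N20 n2q); exists N1; split=> //; first by exists n1.
  by exists (q \oc n1); apply: kernel_zero_mono kk K0.
exists K; split=> //; first by exists k; apply: kernel_mono kk.
have [_ un2] := mono_is_kernel ab mn2 n2q.
have [qk _] := kk; have [|h [hE _]] := un2 _ (n1 \oc k).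
  by rewrite comp_assoc.
exists h; apply: monoP => W g hg.
apply: (mono_eq0 (mono_comp mn1 (kernel_mono kk))).
by rewrite -hE -comp_assoc hg comp_0r.
Qed.

Lemma atom_equiv_refl H : monoform H -> atom_equiv H H.
Proof. by move=> [H0 _]; exists H; split=> //; apply: embeds_refl. Qed.

Lemma atom_equiv_sym H K : atom_equiv H K -> atom_equiv K H.
Proof. by move=> [N [? ? ?]]; exists N. Qed.

Lemma atom_equiv_trans H K M :
  monoform K -> atom_equiv H K -> atom_equiv K M -> atom_equiv H M.
Proof.
move=> mK [N1 [N10 N1H N1K]] [N2 [N20 N2K N2M]].
have [N [N0 NN1 NN2]] := monoform_uniform mK N10 N20 N1K N2K.
by exists N; split=> //; [apply: embeds_trans N1H|apply: embeds_trans N2M].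
Qed.

Lemma ASpec_eq (a b : ASpec A) : atom_set a = atom_set b -> a = b.
Proof.
case: a b => [a aP] [b bP] /= ab; rewrite ab in aP *.
by rewrite (Prop_irrelevance aP bP).
Qed.

Lemma atom_ofP (a : ASpec A) : exists (H : A) (mH : monoform H), atom_of mH = a.
Proof. by have [H mH aE] := atom_setP a; exists H, mH; apply: ASpec_eq. Qed.

Lemma atom_of_eq H K (mH : monoform H) (mK : monoform K) :
  atom_of mH = atom_of mK <-> atom_equiv H K.
Proof.
split=> [|HK].
  move/(congr1 (@atom_set A)) => /= HK.
  have : atom_class K K by split=> //; apply: atom_equiv_refl.
  by rewrite -HK => -[].
apply: ASpec_eq; apply/seteqP; split=> M [mM]/=.
  by move=> HM; split=> //; apply: atom_equiv_trans HM => //; apply: atom_equiv_sym.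
by move=> KM; split=> //; apply: atom_equiv_trans KM.
Qed.

Lemma ASupp_embeds N M : embeds N M -> ASupp N `<=` ASupp M.
Proof.
move=> [n mn] a [H [mH [[X [x [L [l [q [mx ml lq]]]]]] ->]]].
exists H, mH; split=> //; exists X, (n \oc x), L, l, q.
by split=> //; apply: mono_comp.
Qed.

Lemma atom_openT : atom_open [set: ASpec A].
Proof. by move=> a _; have [H [mH <-]] := atom_ofP a; exists H, mH. Qed.

Lemma atom_openI : setI_closed (@atom_open A).
Proof.
move=> P Q oP oQ a [/oP[H [mH [Ha HP]]] /oQ[K [mK [Ka KQ]]]].
have [N [N0 NH NK]] : atom_equiv H K by apply/(atom_of_eq mH mK); rewrite Ha Ka.
have mN := monoform_embeds mH N0 NH.
exists N, mN; split.
  rewrite -Ha; apply/atom_of_eq; exists N; split=> //; exact: embeds_refl.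
move=> b Nb; split.
  exact/HP/(ASupp_embeds NH).
exact/KQ/(ASupp_embeds NK).
Qed.

Lemma atom_open_bigcup (I : Type) (f : I -> set (ASpec A)) :
  (forall i, atom_open (f i)) -> atom_open (\bigcup_i f i).
Proof.
move=> fo a [i _ /fo[H [mH [Ha Hf]]]]; exists H, mH; split=> //.
by apply: subset_trans Hf _; apply: bigcup_sup.
Qed.

HB.instance Definition _ := gen_eqMixin (ASpec A).
HB.instance Definition _ := gen_choiceMixin (ASpec A).
HB.instance Definition _ := isOpenTopological.Build (ASpec A)
  atom_openT atom_openI atom_open_bigcup.

Lemma ASpec_openE : @open (ASpec A) = @atom_open A.
Proof. by []. Qed.

End AbelianTheory.

(* Main.v *)
Require Import Defs.
From mathcomp Require Import all_boot all_order all_algebra.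
From mathcomp Require Import all_classical topology.

(** Let H1, H2 be monoform objects representing distinct atoms a1, a2. The atom
    support of an object is open, since a subquotient of a subquotient is a
    subquotient. If a2 is not in ASupp H1, this set separates the atoms.
    Otherwise a2 is represented by a monoform K = M/L with L <= M <= H1, and L
    is nonzero, as otherwise K would be a subobject of H1 and a1 = a2. Every
    subquotient of K has the form M'/L' with L <= L' <= M' <= H1, so it has no
    nonzero subobject in common with the monoform object H1. Hence ASupp K
    contains a2 but not a1. *)

Set Implicit Arguments.
Unset Strict Implicit.
Unset Printing Implicit Defensive.
Import GRing.Theory.
(* [hom] would otherwise denote the linear maps of MathComp's [vector]. *)
Import Defs.
Local Open Scope classical_set_scope.
Local Open Scope ring_scope.
Local Open Scope cat_scope.

Lemma comp_oppl (A : abelianCat) (X Y Z : A) (g : hom Y Z) (f : hom X Y) :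
  (- g) \oc f = - (g \oc f).
Proof. by apply/eqP; rewrite -addr_eq0 -comp_addl addNr comp_0l. Qed.

Lemma epiP (A : abelianCat) (X Y : A) (f : hom X Y) :
  (forall W (g : hom Y W), g \oc f = 0 -> g = 0) -> epi f.
Proof.
move=> f0 W g h fgh; apply/eqP; rewrite -subr_eq0; apply/eqP/f0.
by rewrite comp_addl comp_oppl fgh subrr.
Qed.

(** [P] is the preimage of [X] under [q], built as the kernel of [M -> K -> K/X]. The last clause
    says that it contains the kernel of [q]. *)
Lemma pullback_mono_epi (A : abelianCat) (M K X : A) (q : hom M K)
    (x : hom X K) :
  epi q -> mono x ->
  exists P (m : hom P M) (r : hom P X),
    [/\ mono m, epi r, q \oc m = x \oc r &
        forall L (l : hom L M), q \oc l = 0 ->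
          exists s : hom L P, m \oc s = l /\ r \oc s = 0].
Proof.
move=> eq mx; have ab := cat_abelian A.
have [C [c xc]] := has_cokernels ab x.
have [cx0 ux] := mono_is_kernel ab mx xc.
have [P [m mk]] := has_kernels ab (c \oc q).
have [cqm0 um] := mk.
have mm := kernel_mono mk.
have [|r [xr _]] := ux _ (q \oc m); first by rewrite comp_assoc.
exists P, m, r; split=> //.
- apply: epiP => W g gr.
  have [J [j jk]] := has_kernels ab g.
  have [gj uj] := jk; have [r' [jr _]] := uj _ _ gr.
  have mxj := mono_comp mx (kernel_mono jk).
  (* J, the kernel of g, is all of X: a map d killing J also kills the preimage
     P of X, hence factors through K/X. *)
  have [D [d dk]] := has_cokernels ab (x \oc j).
  have [dxj ud] := mono_is_kernel ab mxj dk.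
  have [_ uc] := epi_is_cokernel ab
    (epi_comp (cokernel_epi xc) eq) mk.
  have [|s [sE _]] := uc _ (d \oc q).
    by rewrite -comp_assoc -xr -jr !comp_assoc -(comp_assoc d) dxj comp_0l.
  have dE : s \oc c = d by apply: eq; rewrite -comp_assoc.
  (* As [d] factors through [c], it kills [x]; so [x] factors through [x \oc j], the kernel of [d],
     and [j] is split. *)
  have [|u [uE _]] := ud _ x.
    by rewrite -dE -comp_assoc cx0 comp_0r.
  have ju : j \oc u = idm X.
    by apply: mx; rewrite comp_assoc uE comp_idr.
  by rewrite -[g]comp_idr -ju comp_assoc gj comp_0l.
- move=> L l ql0; have [|s [ms _]] := um _ l.
    by rewrite -comp_assoc ql0 comp_0r.
  exists s; split=> //; apply: (mono_eq0 mx).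
  by rewrite comp_assoc xr -comp_assoc ms.
Qed.

(** [M'] is the preimage in [M] of the subobject of [K] that has [P] as a quotient, and [L'] is the
    kernel of [M' -> P]; it contains [L] because [q] kills [L]. *)
Lemma subquotient_cokernel (A : abelianCat) (L M K P : A) (l : hom L M)
    (q : hom M K) :
  mono l -> is_cokernel l q -> subquotient P K ->
  exists M' (m : hom M' M) L' (l' : hom L' M') (p : hom M' P),
    [/\ mono m, mono l', is_cokernel l' p & embeds L L'].
Proof.
move=> ml lq [X [x [Y [y [p [mx my yp]]]]]]; have ab := cat_abelian A.
have [M' [m [r [mm er _ fact]]]] := pullback_mono_epi (cokernel_epi lq) mx.
have [L' [l' lk]] := has_kernels ab (p \oc r).
have [s [ms rs]] := fact _ l (proj1 lq).
have [t [lt _]] : exists! t, l' \oc t = s.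
  by apply: (proj2 lk); rewrite -comp_assoc rs comp_0r.
exists M', m, L', l', (p \oc r); split=> //.
- exact: kernel_mono lk.
- apply: (epi_is_cokernel ab _ lk).
  exact: epi_comp (cokernel_epi yp) er.
- exists t; apply: monoP => W g tg; apply: (mono_eq0 ml).
  by rewrite -ms -lt -!comp_assoc tg !comp_0r.
Qed.

Lemma subquotient_trans (A : abelianCat) (P K M : A) :
  subquotient P K -> subquotient K M -> subquotient P M.
Proof.
move=> PK [M1 [m1 [L [l [q [mm1 ml lq]]]]]].
have [M' [m [L' [l' [p [mm ml' lp _]]]]]] := subquotient_cokernel ml lq PK.
by exists M', (m1 \oc m), L', l', p; split=> //; apply: mono_comp.
Qed.

Lemma subquotient_refl (A : abelianCat) (M : A) : subquotient M M.
Proof.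
have [Z Z0] := has_zero (cat_abelian A); have [Zs Zt] := Z0.
exists M, (idm M), Z, 0, (idm M); split; first exact: mono_id.
  by move=> W g h _; rewrite (Zt _ g) (Zt _ h).
split; first by rewrite comp_0r.
move=> W g _; exists g; split; first by rewrite comp_idr.
by move=> h; rewrite comp_idr.
Qed.

Lemma ASupp_open (A : abelianCat) (M : A) : atom_open (ASupp M).
Proof.
move=> _ [H [mH [HM ->]]]; exists H, mH; split=> // _ [K [mK [KH ->]]].
by exists K, mK; split=> //; apply: subquotient_trans HM.
Qed.

Lemma ASupp_atom_of (A : abelianCat) (H : A) (mH : monoform H) :
  ASupp H (atom_of mH).
Proof. by exists H, mH; split=> //; apply: subquotient_refl. Qed.

(** Since [K = M/L] embeds in [H/L], a nonzero subobject common to [H] and [K] would contradict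
    monoformity of [H]. *)
Lemma monoform_not_atom_equiv_quotient (A : abelianCat) (H M L K : A)
    (m : hom M H) (l : hom L M) (q : hom M K) :
  monoform H -> mono m -> mono l -> is_cokernel l q -> ~ is_zero L ->
  ~ atom_equiv H K.
Proof.
move=> [_ mH] mm ml lq L0 [N [N0 NH NK]].
have mml := mono_comp mm ml.
have [Q [p mlp]] := has_cokernels (cat_abelian A) (m \oc l).
apply: (mH _ _ _ _ mml L0 mlp); exists N; split=> //.
by apply: embeds_trans NK _; apply: quotient_mono lq mlp.
Qed.

(** The identity of [M] kills [l = 0], so it factors through [q], and the factor is inverse to
    [q]. *)
Lemma cokernel_zero_embeds (A : abelianCat) (L M K : A) (l : hom L M)
    (q : hom M K) :
  is_cokernel l q -> is_zero L -> embeds K M.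
Proof.
move=> lq [L0 _]; have [|h [hq _]] := proj2 lq _ (idm M).
  by rewrite (L0 _ l) comp_0r.
have qh : q \oc h = idm K.
  by apply: (cokernel_epi lq); rewrite -comp_assoc hq comp_idr comp_idl.
exists h; apply: monoP => W g hg.
by rewrite -[g]comp_idl -qh -comp_assoc hg comp_0r.
Qed.

Lemma ASpec_separated (A : abelianCat) (a1 a2 : ASpec A) : a1 <> a2 ->
  exists U : set (ASpec A),
    atom_open U /\ ((U a1 /\ ~ U a2) \/ (U a2 /\ ~ U a1)).
Proof.
have [H [mH <-]] := atom_ofP a1 => a12.
have [a2H|a2H] := pselect (ASupp H a2); last first.
  exists (ASupp H); split; first exact: ASupp_open.
  by left; split=> //; apply: ASupp_atom_of.
have [K [mK [[M [m [L [l [q [mm ml lq]]]]]] a2K]]] := a2H.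
rewrite a2K in a12 *.
have L0 : ~ is_zero L.
  move=> L0; apply: a12; apply/atom_of_eq; exists K; split.
  - exact: (proj1 mK).
  - by apply: embeds_trans (cokernel_zero_embeds lq L0) _; exists m.
  - exact: embeds_refl.
exists (ASupp K); split; first exact: ASupp_open.
right; split; first exact: ASupp_atom_of.
(* A subquotient [P] of [K] equivalent to [H] would be [M'/L'] inside [H], with [L'] nonzero because
   it contains [L]. *)
move=> [P [mP [PK /atom_of_eq HP]]].
have [M' [m' [L' [l' [p [mm' ml' lp [t mt]]]]]]] :=
  subquotient_cokernel ml lq PK.
apply: (monoform_not_atom_equiv_quotient mH (mono_comp mm mm') ml' lp _ HP).
by move=> L'0; apply: L0; apply: zero_mono mt L'0.
Qed.

Theorem proposition3p5 (A : abelianCat) :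
  kolmogorov_space (ASpec A) /\
  forall a1 a2 : ASpec A, a1 <> a2 ->
    exists U : set (ASpec A),
      open U /\ ((U a1 /\ ~ U a2) \/ (U a2 /\ ~ U a1)).
Proof.
split; last exact: ASpec_separated.
(* [kolmogorov_space] asks for a neighbourhood, and an open class is one of each of its points. *)
move=> a b /eqP ab; have [U [oU [[Ua Ub]|[Ub Ua]]]] := ASpec_separated ab.
- exists U; left; rewrite !inE; split=> //.
  by apply: open_nbhs_nbhs; split.
- exists U; right; rewrite !inE; split=> //.
  by apply: open_nbhs_nbhs; split.
Qed.
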